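(* For every integer $k \geq 2$ there exists an integer $n_0$ such that for every odd integer $n \geq n_0$ there exists an $n$-vertex graph $G$ satisfying $\kappa(G) = \alpha(G) = k$ and $\mathcal{C}_n(G) \neq \mathcal{C}(G)$.
   Context: Graphs are finite and simple. $\kappa(G)$ is the vertex-connectivity of $G$ and $\alpha(G)$ is its independence number. The cycle space $\mathcal{C}(G)$ is the vector space over $\mathbb{F}_2$ spanned by the incidence vectors (in $\mathbb{F}_2^{E(G)}$) of the edge-sets of all cycles of $G$. If $G$ has $n$ vertices, $\mathcal{C}_n(G)$ is the subspace of $\mathcal{C}(G)$ spanned by the incidence vectors of the edge-sets of cycles of length $n$ in $G$, i.e. of Hamilton cycles of $G$. *)

(* Defs.v *)
From mathcomp Require Import all_boot all_algebra.

Set Implicit Arguments.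
Unset Strict Implicit.
Unset Printing Implicit Defensive.

Import GRing.Theory.

Record sgraph := SGraph {
  vertex :> finType;
  adj : rel vertex;
  adj_sym : symmetric adj;
  adj_irr : irreflexive adj
}.

Definition edge_set (G : sgraph) : {set {set G}} :=
  [set [set p.1; p.2] | p : G * G & adj p.1 p.2].

Notation edge G := {A : {set vertex G} | A \in edge_set G}.

(** Vertex-connectivity *)

Definition adj_minus (G : sgraph) (X : {set G}) : rel G :=
  fun x y => [&& x \notin X, y \notin X & adj x y].

Definition connected_minus (G : sgraph) (X : {set G}) : bool :=
  [forall x in ~: X, forall y in ~: X, connect (adj_minus X) x y].

(* The size condition makes complete graphs on m vertices (m - 1)-connected
   and not m-connected. *)
Definition k_connected (G : sgraph) (k : nat) : bool :=
  (k < #|G|) && [forall X : {set G}, (#|X| < k) ==> connected_minus X].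

Definition kappa (G : sgraph) : nat := \max_(k < #|G| | k_connected G k) k.

(** Independence number *)

Definition independent (G : sgraph) (S : {set G}) : bool :=
  [forall x in S, forall y in S, ~~ adj x y].

Definition alpha (G : sgraph) : nat :=
  \max_(S : {set G} | independent S) #|S|.

(** Cycle space *)

Definition is_cycle (G : sgraph) (c : seq G) : bool :=
  [&& 3 <= size c, uniq c & cycle (@adj G) c].

Definition cycle_edges (G : sgraph) (c : seq G) : {set edge G} :=
  [set a : edge G | [exists x in c, val a == [set x; next c x]]].

Definition cycles_of_length (G : sgraph) (l : nat) : {set {set edge G}} :=
  [set cycle_edges c | c : l.-tuple G & is_cycle c].

(* A cycle has no repeated vertex, hence length at most #|G|. *)
Definition all_cycles (G : sgraph) : {set {set edge G}} :=
  \bigcup_(l < #|G|.+1) cycles_of_length G l.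

(* ('F_2)^o is 'F_2 seen as a vector space over itself. *)
Notation edge_space G := {ffun edge G -> ('F_2)^o}.

Definition incidence (G : sgraph) (C : {set edge G}) : edge_space G :=
  [ffun a => (a \in C)%:R%R].

Definition cycle_space (G : sgraph) : {vspace edge_space G} :=
  <<[seq incidence C | C in all_cycles G]>>%VS.

Definition cycle_space_of_length (G : sgraph) (l : nat)
    : {vspace edge_space G} :=
  <<[seq incidence C | C in cycles_of_length G l]>>%VS.

(* Main.v *)
Require Import Defs.
From mathcomp Require Import all_boot all_algebra.

(** Take a clique [A] on [k] vertices and join it completely to the disjoint
    union of [k - 1] isolated vertices (the set [B]) and one non-empty clique
    [C] of arbitrary size.  Deleting [A] leaves exactly [k] components, each of
    them a clique, so the connectivity and the independence number are both
    [k], and the size of [C] can be adjusted to give any order [n >= 2 * k].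

    A Hamilton cycle has to visit the [k] components of [G - A], and the only
    way of passing from one to another is through one of the [k] vertices of
    [A]; it cannot afford to use two of them consecutively
    ([hamilton_avoids_separator]).  Hence an edge inside [A], which exists as
    [k >= 2], lies on no Hamilton cycle, and its coordinate vanishes on
    the span of the Hamilton cycles.  It does not vanish on the triangle formed
    by this edge and a vertex of [C] ([cycle_space_of_length_neq]). *)

Set Implicit Arguments.
Unset Strict Implicit.
Unset Printing Implicit Defensive.

Import GRing.Theory.

(** * Graphs in general *)

(** The coordinate at [e] is a linear form that separates the two spaces. *)
Lemma cycle_space_of_length_neq (G : sgraph) (l : nat) (e : edge G)
    (c : seq G) :
  is_cycle c -> e \in cycle_edges c ->
  (forall c' : seq G, size c' = l -> is_cycle c' -> e \notin cycle_edges c') ->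
  cycle_space_of_length G l <> cycle_space G.
Proof.
move=> cyc_c e_c avoid eq_spaces.
have all_c : cycle_edges c \in all_cycles G.
  have c_lt : size c < #|G|.+1.
    by case/and3P: cyc_c => _ /card_uniqP <- _; rewrite ltnS max_card.
  apply/bigcupP; exists (Ordinal c_lt) => //=.
  by apply/imsetP; exists (in_tuple c); rewrite ?inE.
have : incidence (cycle_edges c) \in cycle_space_of_length G l.
  by rewrite eq_spaces; apply/memv_span/image_f.
rewrite /cycle_space_of_length -[X in <<X>>%VS]in_tupleE => /coord_span inc_c.
have /eqP := congr1 (fun f : edge_space G => f e) inc_c.
rewrite ffunE e_c sum_ffunE big1 ?oner_eq0 // => i _.
rewrite ffunE in_tupleE; set X := image _ _.
have /imageP [_ /imsetP [c' c'_cyc ->] ->] : (X`_i)%R \in X.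
  by apply/mem_nth.
rewrite ffunE (negPf (avoid c' _ _)) ?size_tuple ?scaler0 //.
by rewrite inE in c'_cyc.
Qed.

(** On the cycle, the predecessors of the vertices of [I] lie in [S].  If the
    successor of [x] were in [S] too, they would avoid [x], and by counting they
    would be all the other vertices of [S].  Then the successor of every vertex
    of [S] would lie in [S :|: I], and the cycle could never reach [z]. *)
Lemma hamilton_avoids_separator (G : sgraph) (S I : {set G}) (c : seq G)
    (x z : G) :
  (forall u v, u \in I -> adj u v -> v \in S) -> [disjoint S & I] ->
  #|S| <= #|I|.+1 -> z \notin S :|: I ->
  is_cycle c -> size c = #|G| -> x \in S -> next c x \notin S.
Proof.
move=> nbrI disjSI cardS zSI /and3P [_ uniq_c cyc_c] size_c xS.
apply/negP => nxS.
have in_c v : v \in c.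
  have /subset_cardP/(_ (subset_predT _)) -> // : #|c| = #|G|.
  by rewrite (card_uniqP uniq_c).
have adj_next v : adj v (next c v) by apply: next_cycle.
have prevK := next_prev uniq_c.
have prevI : prev c @: I = S :\ x.
  apply/eqP; rewrite eqEcard; apply/andP; split.
    apply/subsetP => _ /imsetP [v vI ->]; rewrite !inE; apply/andP; split.
      apply: contraTneq vI => px.
      by rewrite (disjointFr disjSI) // -(prevK v) px.
    by apply: (nbrI v) => //; rewrite adj_sym -{2}(prevK v).
  rewrite (card_imset _ (can_inj prevK)) -ltnS; apply: leq_trans cardS.
  by rewrite (cardsD1 x S) xS.
have next_closed v : v \in S :|: I -> next c v \in S :|: I.
  rewrite !inE => /orP [vS | vI]; last by rewrite (nbrI v).
  have [-> | v_x] := eqVneq v x; first by rewrite nxS.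
  have : v \in prev c @: I by rewrite prevI !inE v_x.
  by case/imsetP => w wI ->; rewrite prevK wI orbT.
have xz : fconnect (next c) x z.
  by rewrite (fconnect_cycle (cycle_next uniq_c) (in_c x)).
case/negP: zSI; move/iter_findex: xz => <-.
by elim: (findex _ _ _) => [|m IHm]; rewrite ?iterS ?next_closed // inE xS.
Qed.

(** A separating set of size [k] bounds the connectivity from above, as
    [k_connected] quantifies over all smaller sets. *)
Lemma kappa_eq (G : sgraph) (k : nat) (X : {set G}) :
  k_connected G k -> #|X| = k -> ~~ connected_minus X -> kappa G = k.
Proof.
move=> conn_k cardX sepX; apply/eqP; rewrite eqn_leq; apply/andP; split.
  apply/bigmax_leqP => j /andP [_ /forallP /(_ X)].
  by rewrite cardX (negPf sepX) implybF -leqNgt.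
have k_lt : k < #|G| by case/andP: conn_k.
exact: (@leq_bigmax_cond _ _ _ (Ordinal k_lt)).
Qed.

(** * The graphs of the construction *)

Section SplitJoin.

Variables A B C : finType.

(** The join of a clique on [A] with the disjoint union of the edgeless graph
    on [B] and a clique on [C]. *)
Definition split_join_adj : rel (A + (B + C)) := fun x y =>
  (x != y) && match x, y with
              | inr (inl _), inr _ | inr _, inr (inl _) => false
              | _, _ => true
              end.

Lemma split_join_sym : symmetric split_join_adj.
Proof.
by move=> x y; rewrite /split_join_adj eq_sym; case: x y => [?|[?|?]] [?|[?|?]].
Qed.

Lemma split_join_irr : irreflexive split_join_adj.
Proof. by move=> x; rewrite /split_join_adj eqxx. Qed.

Definition split_join : sgraph := SGraph split_join_sym split_join_irr.

Definition core : {set split_join} := [set inl a | a : A].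

(** These vertices become isolated once [core] is deleted. *)
Definition isolated : {set split_join} := [set inr (inl b) | b : B].

Lemma mem_core (x : split_join) :
  (x \in core) = (if x is inl _ then true else false).
Proof.
case: x => [a|x]; first by rewrite imset_f.
by apply/negP => /imsetP [].
Qed.

Lemma mem_isolated (x : split_join) :
  (x \in isolated) = (if x is inr (inl _) then true else false).
Proof.
by case: x => [a|[b|c]]; [apply/negP => /imsetP [] | rewrite imset_f
                         | apply/negP => /imsetP []].
Qed.

Lemma card_core : #|core| = #|A|.
Proof. by rewrite card_imset // => a a' []. Qed.

Lemma card_isolated : #|isolated| = #|B|.
Proof. by rewrite card_imset // => b b' []. Qed.

(** Fewer than [#|A|] deletions spare a vertex of [A], which is adjacent to
    everything else; deleting [A] cuts [b0] off from [c0]. *)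
Lemma kappa_split_join (b0 : B) (c0 : C) : kappa split_join = #|A|.
Proof.
apply: (@kappa_eq _ _ core); last 2 first.
- exact: card_core.
- apply/negP => /forallP /(_ (inr (inl b0))); rewrite inE mem_core /=.
  move=> /forallP /(_ (inr (inr c0))); rewrite inE mem_core /=.
  case/connectP => [[|y p]] //= /andP [/and3P [_]].
  rewrite mem_core /= /split_join_adj.
  by case: y => [a|[b|c]]; rewrite ?andbF.
apply/andP; split.
  by rewrite !card_sum -addn1 leq_add2l; apply/ltn_addr/card_gt0P; exists b0.
apply/forallP => X; apply/implyP => ltX.
have [a aX] : exists a : A, inl a \notin X.
  have /subsetPn [_ /imsetP [a _ ->] aX] : ~~ (core \subset X).
    by apply: contraL ltX => /subset_leq_card; rewrite card_core -leqNgt.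
  by exists a.
have to_a x : x \notin X -> connect (adj_minus X) x (inl a).
  move=> xX; have [-> // | x_a] := eqVneq x (inl a).
  apply: connect1; rewrite /adj_minus xX aX /= /split_join_adj x_a /=.
  by case: x {xX x_a} => [?|[?|?]].
have symX : connect_sym (adj_minus X).
  by apply: sym_connect_sym => x y; rewrite /adj_minus adj_sym andbCA.
apply/forall_inP => x; rewrite inE => /to_a xa.
apply/forall_inP => y; rewrite inE => /to_a ya.
by apply: connect_trans xa _; rewrite symX.
Qed.

(** The vertices split into [#|B|.+1] cliques, namely the single vertices of
    [B] and the union of [A] and [C], and an independent set meets each of them
    at most once.  A vertex of [C] together with [B] attains the bound. *)
Lemma alpha_split_join (c0 : C) : alpha split_join = #|B|.+1.
Proof.
apply/eqP; rewrite eqn_leq; apply/andP; split; last first.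
  have cardT : #|inr (inr c0) |: isolated| = #|B|.+1.
    by rewrite cardsU1 mem_isolated card_isolated.
  rewrite -cardT; apply: leq_bigmax_cond.
  apply/forall_inP => x; rewrite in_setU1 mem_isolated => xT.
  apply/forall_inP => y; rewrite in_setU1 mem_isolated => yT.
  case/orP: xT => [/eqP -> | ]; case/orP: yT => [/eqP -> | ] //=.
  - by rewrite split_join_irr.
  - by case: y => [|[|]] // b _; rewrite /= /split_join_adj andbF.
  - by case: x => [|[|]] // b _; rewrite /= /split_join_adj andbF.
  - by case: x y => [|[|]] // b [|[|]] // b' _ _; rewrite /split_join_adj andbF.
apply/bigmax_leqP => X /forall_inP indX.
(* [None] is the index of the clique formed by [A] and [C]. *)
pose block (x : split_join) := if x is inr (inl b) then Some b else None.
rewrite -card_option; have <- : #|block @: X| = #|X|; last exact: max_card.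
apply: card_in_imset => x y xX yX; apply: contra_eq => x_y.
have := forall_inP (indX x xX) y yX; rewrite /= /split_join_adj x_y /=.
by case: x y x_y {xX yX} => [?|[?|?]] [?|[?|?]].
Qed.

End SplitJoin.

Theorem proposition1p5 :
  forall k : nat, 2 <= k ->
  exists n0 : nat, forall n : nat, odd n -> n0 <= n ->
  exists G : sgraph,
    [/\ #|G| = n, kappa G = k, alpha G = k &
        cycle_space_of_length G n <> cycle_space G].
Proof.
case=> [|[|k]] // _; exists (k.+2 + k.+2) => n _ le_n.
have [q def_n] : exists q, n = k.+2 + (k.+1 + q.+1).
  by exists (n - (k.+2 + k.+2)); rewrite -addSnnS addnA subnKC.
(* The core has [k.+2] vertices, and [k.+1] isolated vertices together with the
   clique on ['I_q.+1] make [k.+2] components outside it. *)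
pose G := split_join 'I_k.+2 'I_k.+1 'I_q.+1.
have cardG : #|G| = n by rewrite !card_sum !card_ord.
exists G; split => //.
- by rewrite (kappa_split_join _ (ord0 : 'I_k.+1) (ord0 : 'I_q.+1)) card_ord.
- by rewrite (alpha_split_join _ _ (ord0 : 'I_q.+1)) card_ord.
pose a0 : G := inl ord0; pose a1 : G := inl ord_max.
pose c0 : G := inr (inr ord0).
have edge_a : [set a0; a1] \in edge_set G.
  by apply/imsetP; exists (a0, a1); rewrite ?inE.
apply: (@cycle_space_of_length_neq G n (exist _ [set a0; a1] edge_a)
          [:: a0; a1; c0]) => //.
  by rewrite inE; apply/existsP; exists a0; rewrite !inE /= !eqxx.
move=> c size_c cyc_c; rewrite inE; apply/negP => /existsP [x /andP [xc]].
rewrite /= => /eqP eq_edge.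
have sub_core : [set a0; a1] \subset core _ _ _.
  by rewrite subUset !sub1set !mem_core.
have xS : x \in core _ _ _ by rewrite (subsetP sub_core) // eq_edge !inE eqxx.
have : next c x \in core _ _ _.
  by rewrite (subsetP sub_core) // eq_edge !inE eqxx orbT.
apply/negP.
apply: (@hamilton_avoids_separator G _ (isolated _ _ _) c x c0) => //.
- move=> u v; rewrite mem_isolated mem_core => uI /andP [_].
  by case: u v uI => [|[]] // b [].
- rewrite disjoint_subset; apply/subsetP => u.
  by rewrite !inE mem_core mem_isolated; case: u.
- by rewrite card_core card_isolated !card_ord.
- by rewrite in_setU mem_core mem_isolated.
- by rewrite size_c cardG.
Qed.
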